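(* Let $n\ge 1$ be an integer and let $\mathrm{Dic}_n=\langle a,x\mid a^{2n}=1,\ x^2=a^n,\ x^{-1}ax=a^{-1}\rangle$ be the dicyclic group of order $4n$. Then $$\mathcal{V}(\mathrm{Dic}_n)=\frac{\omega(2n)}{\tau(2n)+\sigma(n)}.$$
   Context: For a finite group $G$, $L(G)$ denotes the set of all subgroups of $G$ (including the trivial subgroup and $G$ itself), $s(G)$ denotes the number of subgroups of $G$ that are simple groups (the trivial group is not simple; cyclic groups of prime order are simple), and $\mathcal{V}(G)=s(G)/|L(G)|$. Subgroups are counted as subsets of $G$. For a positive integer $m$: $\omega(m)$ is the number of distinct prime factors of $m$, $\tau(m)$ the number of positive divisors of $m$, and $\sigma(m)$ the sum of the positive divisors of $m$. *)

(* Defs.v *)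
From mathcomp Require Import all_boot all_order all_algebra all_fingroup all_solvable.

Set Implicit Arguments.
Unset Strict Implicit.
Unset Printing Implicit Defensive.

(* [simple] excludes the trivial group and holds for cyclic groups of prime
   order; subgroups are
   elements of {group gT}, hence counted as subsets of G. *)
Definition nb_simple_subgroups (gT : finGroupType) (G : {group gT}) : nat :=
  #|[set H in subgroups G | simple H]|.

Definition simple_ratio (gT : finGroupType) (G : {group gT}) : rat :=
  ((nb_simple_subgroups G)%:R / #|subgroups G|%:R)%R.

Definition omega (m : nat) : nat := size (primes m).

Definition tau (m : nat) : nat := size (divisors m).

Definition sigma (m : nat) : nat := \sum_(d <- divisors m) d.

(* Main.v *)
(** Let C = <a>, cyclic of order 2n and index 2, and z = a^n, its unique
    involution; every y outside C satisfies y^2 = z.  The subgroups of C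
    contribute tau(2n).  A subgroup H not contained in C contains z, and for a
    fixed K <= C containing z, each of the 2n elements y outside C lies in
    exactly one H with H :&: C = K, namely K<y>, while each such H contains
    |K| of them: so there are |C : K| such H, and these indices run over the
    divisors of n as K varies, whence sigma(n).  A simple subgroup
    outside C would equal <z>, which is normal in it but lies in C; so the
    simple subgroups are the ones of prime order in C.  That the presentation does define a group of order 4n is
    seen on permutations satisfying the relations. *)
Require Import Defs.
From mathcomp Require Import all_boot all_order all_algebra all_fingroup all_solvable.
From mathcomp Require Import zify.

Set Implicit Arguments.
Unset Strict Implicit.
Unset Printing Implicit Defensive.

(** * Subgroups of a cyclic group, counted by index and by simplicity *)

Section CyclicSubgroups.

Import GroupScope.

(** In a cyclic group the order, hence the index, determines a subgroup, and index [m] is realised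
    by [<[c ^+ m]>]. Taking [d = 1] covers all subgroups, [d = 2] those containing the
    involution. *)
Lemma cyclic_subgroups_index (gT : finGroupType) (C : {group gT}) (d : nat) :
  cyclic C -> d %| #|C| ->
  perm_eq [seq #|C : K| | K : {group gT} <- enum [set K in subgroups C | d %| #|K|]]
          (divisors (#|C| %/ d)).
Proof.
move=> cycC dvdC.
have d_gt0 : 0 < d by rewrite (dvdn_gt0 _ dvdC) ?cardG_gt0.
have Cd_gt0 : 0 < #|C| %/ d by rewrite divn_gt0 // dvdn_leq ?cardG_gt0.
apply: uniq_perm; rewrite ?divisors_uniq //.
  rewrite map_inj_in_uniq ?enum_uniq // => H K.
  rewrite !mem_enum !inE => /andP[sHC _] /andP[sKC _] eqHK.
  apply/val_inj/eqP; rewrite /= (eq_subG_cyclic cycC) //.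
  rewrite -(eqn_pmul2r (indexg_gt0 C H)) {2}eqHK.
  by rewrite !Lagrange.
move=> m; rewrite -dvdn_divisors // dvdn_divRL //.
apply/mapP/idP => [[K] | dvd_md].
  rewrite mem_enum !inE => /andP[sKC dvdK] ->.
  by rewrite mulnC -(Lagrange sKC) dvdn_pmul2r.
have dvdm : m %| #|C| := dvdn_trans (dvdn_mulr d (dvdnn m)) dvd_md.
have m_gt0 : 0 < m by rewrite (dvdn_gt0 _ dvdm) ?cardG_gt0.
have [c defC] := cyclicP cycC.
have oK : #|<[c ^+ m]>| = #|C| %/ m.
  by rewrite -orderE orderXdiv orderE -defC.
have sKC : <[c ^+ m]> \subset C by rewrite defC cycleX.
exists <[c ^+ m]>%G.
  by rewrite mem_enum !inE sKC oK dvdn_divRL // mulnC.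
by rewrite -divgS //= oK divnA // mulKn ?cardG_gt0.
Qed.

(** The order map is a bijection onto the primes dividing [#|C|]: a solvable simple group has prime
    order, and Cauchy provides every such prime. *)
Lemma card_simple_subgroups_cyclic (gT : finGroupType) (C : {group gT}) :
  cyclic C -> #|[set K in subgroups C | simple K]| = size (primes #|C|).
Proof.
move=> cycC; rewrite cardE -(size_map (fun K : {group gT} => #|K|)).
apply/perm_size/uniq_perm; rewrite ?primes_uniq //.
  rewrite map_inj_in_uniq ?enum_uniq // => H K.
  rewrite !mem_enum !inE => /andP[sHC _] /andP[sKC _] eqHK.
  by apply/val_inj/eqP; rewrite /= (eq_subG_cyclic cycC) // eqHK.
move=> p; rewrite mem_primes cardG_gt0 /=.
apply/mapP/andP => [[K] | [p_pr dvdp]].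
  rewrite mem_enum !inE => /andP[sKC simK] ->; split; last exact: cardSg.
  apply: simple_sol_prime simK.
  exact: abelian_sol (abelianS sKC (cyclic_abelian cycC)).
have [x Cx ox] := Cauchy p_pr dvdp.
exists <[x]>%G; last by rewrite -orderE.
rewrite mem_enum !inE cycle_subG Cx /=.
apply/simpleP; split=> [|H /normal_sub sHx].
  by rewrite -cardG_gt1 -orderE ox prime_gt1.
have /primeP[_ /(_ #|H|)] := p_pr; rewrite -{1}ox orderE => /(_ (cardSg sHx)).
case/orP=> /eqP oH; first by left; apply: card1_trivg.
by right; apply/eqP; rewrite eqEcard sHx oH -ox orderE /=.
Qed.

End CyclicSubgroups.

(** * Groups with a cyclic subgroup of index 2 outside which all squares are one involution *)

Section CyclicIndexTwo.

Import GroupScope.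

Variables (gT : finGroupType) (G C : {group gT}) (z : gT).

Hypotheses (cycC : cyclic C) (sCG : C \subset G) (indexC : #|G : C| = 2).
Hypotheses (oz : #[z] = 2) (sqr_z : {in G :\: C, forall y, y ^+ 2 = z}).

Let nsCG : C <| G := index2_normal sCG indexC.

Let nsubG (K : {group gT}) : K \subset C -> K <| G.
Proof.
by move=> sKC; apply: char_normal_trans nsCG; rewrite sub_cyclic_char.
Qed.

Let C_z : z \in C.
Proof.
have /subsetPn[y Gy nCy] : ~~ (G \subset C) by rewrite -indexg_gt1 indexC.
rewrite -(@sqr_z y) ?inE ?Gy ?nCy //.
have := rcoset_index2 sCG indexC (x := y).
rewrite inE Gy nCy => /(_ isT) defGC.
(* Were [y ^+ 2] outside [C], it would lie in [C :* y], and cancelling [y] would put [y] in [C]. *)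
apply: contraTT (rcoset_refl C y) => nCy2.
have: y ^+ 2 \in C :* y by rewrite defGC inE nCy2 groupX.
by rewrite mem_rcoset expgS expg1 mulgK (negbTE nCy).
Qed.

Lemma not_sub_z_in (H : {group gT}) :
  H \subset G -> ~~ (H \subset C) -> z \in H.
Proof.
move=> sHG /subsetPn[y Hy nCy].
by rewrite -(@sqr_z y) ?groupX // inE nCy (subsetP sHG).
Qed.

Lemma setD_not_sub (H : {group gT}) (y : gT) :
  H \subset G -> y \in H :\: C -> H :\: C = (H :&: C) :* y.
Proof.
move=> sHG /setDP[Hy nCy].
have defGC : C :* y = G :\: C.
  by apply: rcoset_index2 => //; rewrite inE nCy (subsetP sHG).
apply/setP=> h; rewrite mem_rcoset 2!inE groupMr ?groupV //.
case Hh: (h \in H); rewrite ?andbF // andbT /=.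
by rewrite -mem_rcoset defGC inE (subsetP sHG) ?andbT.
Qed.

(** By the modular law the intersection is [K * (<[y]> :&: C)]. Even powers of [y] are powers of
    [z], so they lie in [K]; odd ones lie outside [C]. *)
Lemma join_cycle_setI (K : {group gT}) (y : gT) :
  K \subset C -> z \in K -> y \in G :\: C -> (K <*> <[y]>) :&: C = K.
Proof.
move=> sKC Kz GCy; have /setDP[Gy nCy] := GCy.
have nKy : <[y]> \subset 'N(K).
  by rewrite cycle_subG (subsetP (normal_norm (nsubG sKC))).
rewrite norm_joinEr // -group_modl //; apply: mulGSid.
apply/subsetP=> _ /setIP[/cycleP[j ->]].
rewrite -(odd_double_half j) expgD -mul2n expgM (sqr_z GCy).
case: (odd j); last by rewrite expg0 mul1g => _; apply: groupX.
by rewrite expg1 groupMr ?groupX // (negbTE nCy).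
Qed.

Lemma card_subgroups_setI (K : {group gT}) : K \subset C -> z \in K ->
  #|[set H in subgroups G | ~~ (H \subset C) && (H :&: C == K)]| = #|C : K|.
Proof.
move=> sKC Kz; set S := [set H in _ | _].
(* After multiplication by [#|K|], both sides count the elements of [G :\: C]: the right one as a
   coset of [C], the left one through pairs of [H] and [y] in [H :\: C]. *)
apply/eqP; rewrite -(eqn_pmul2r (cardG_gt0 K)) [X in _ == X]mulnC Lagrange //.
have /subsetPn[y0 Gy0 nCy0] : ~~ (G \subset C) by rewrite -indexg_gt1 indexC.
rewrite -(card_rcoset C y0) (rcoset_index2 sCG indexC) ?inE ?nCy0 //.
apply/eqP; rewrite -sum_nat_const -[RHS]sum1_card.
have cardHC (H : {group gT}) : H \in S -> #|K| = \sum_(y in H :\: C) 1.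
  rewrite !inE => /and3P[sHG nsHC /eqP defK].
  have /subsetPn[y Hy nCy] := nsHC.
  by rewrite sum1_card (setD_not_sub (y := y)) ?inE ?nCy // card_rcoset defK.
rewrite (eq_bigr _ cardHC) (exchange_big_dep (mem (G :\: C))) /=; last first.
  move=> H y; rewrite !inE => /and3P[sHG _ _] /andP[-> Hy].
  exact: (subsetP sHG).
apply: eq_bigr => y GCy; have /setDP[Gy nCy] := GCy.
rewrite (big_pred1 (K <*> <[y]>)%G) // => H; rewrite !inE nCy /=.
apply/idP/eqP => [/andP[/and3P[sHG nsHC /eqP defK] Hy] | ->]; last first.
  have sKyG : K <*> <[y]> \subset G.
    by rewrite join_subG (subset_trans sKC) // cycle_subG.
  have yKy : y \in K <*> <[y]> by rewrite (subsetP (joing_subr _ _)) ?cycle_id.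
  rewrite /= sKyG join_cycle_setI // eqxx yKy !andbT.
  by apply/subsetPn; exists y.
apply/val_inj/eqP; rewrite /= eq_sym eqEsubset join_subG cycle_subG Hy.
rewrite -{1}defK subsetIl /=.
rewrite -{1}(setID H C) (setD_not_sub (y := y)) ?inE ?nCy // defK.
rewrite subUset joing_subl mul_subG ?joing_subl //.
by rewrite sub1set (subsetP (joing_subr _ _)) ?cycle_id.
Qed.

(** In a cyclic group, the subgroup [<[z]>] of order 2 lies in every subgroup of even order. *)
Lemma dvd2_z_in (K : {group gT}) : K \subset C -> (2 %| #|K|) = (z \in K).
Proof.
move=> sKC; rewrite -oz; apply/idP/idP => [|Kz]; last exact: order_dvdG.
by rewrite orderE (cardSg_cyclic cycC) ?cycle_subG.
Qed.

Lemma card_subgroups_not_sub :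
  #|[set H in subgroups G | ~~ (H \subset C)]| = sigma (#|C| %/ 2).
Proof.
have dvd2C : 2 %| #|C| by rewrite dvd2_z_in.
rewrite -sum1_card.
pose cap (H : {group gT}) : {group gT} := (H :&: C)%G.
rewrite (partition_big cap (mem [set K in subgroups C | 2 %| #|K|])) /=; last first.
  move=> H; rewrite !inE => /andP[sHG nsHC].
  by rewrite subsetIr dvd2_z_in ?subsetIr // inE C_z (not_sub_z_in sHG).
rewrite /sigma -(perm_big _ (cyclic_subgroups_index cycC dvd2C)) /=.
rewrite big_map big_enum /=; apply: eq_bigr => K; rewrite !inE => /andP[sKC].
rewrite dvd2_z_in // => Kz; rewrite -(card_subgroups_setI sKC Kz) -sum1_card.
by apply: eq_bigl => H; rewrite !inE andbA.
Qed.

Lemma card_subgroups_sub : #|[set H in subgroups G | H \subset C]| = tau #|C|.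
Proof.
rewrite /tau -(divn1 #|C|).
rewrite -(perm_size (cyclic_subgroups_index cycC (dvd1n _))) size_map -cardE.
apply: eq_card => H; rewrite !inE dvd1n andbT andbC.
by case: (boolP (H \subset C)) => // sHC; rewrite (subset_trans sHC).
Qed.

Lemma card_subgroups_cyclic_index2 :
  #|subgroups G| = tau #|C| + sigma (#|C| %/ 2).
Proof.
rewrite -card_subgroups_sub -card_subgroups_not_sub.
rewrite -(cardsID [set H : {group gT} | H \subset C]).
congr (_ + _); apply: eq_card => H; rewrite !inE //; exact: andbC.
Qed.

Lemma nb_simple_subgroups_cyclic_index2 : nb_simple_subgroups G = omega #|C|.
Proof.
rewrite /nb_simple_subgroups /omega -card_simple_subgroups_cyclic //.
apply: eq_card => H; rewrite !inE; apply/andP/andP => -[sHX simH]; last first.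
  by rewrite (subset_trans sHX).
split=> //; apply: contraT => nsHC.
have Hz := not_sub_z_in sHX nsHC.
have nzH : <[z]> <| H.
  by apply: (normalS _ sHX); rewrite ?cycle_subG // nsubG // cycle_subG.
have [_ /(_ _ nzH)[/eqP | defH]] := simpleP _ simH.
  by rewrite cycle_eq1 -order_eq1 oz.
by rewrite -defH cycle_subG C_z in nsHC.
Qed.

End CyclicIndexTwo.

(** * From the presentation to the order and structure of the dicyclic group *)

Section DicyclicOrder.

Import GroupScope.

(* Right translations by a and x in the normal form a ^ i * x ^ b, encoded as
   the pair (i, b). *)
Lemma dicyclic_faithful_model (n : nat) : 0 < n ->
  exists (rT : finGroupType) (a x : rT),
    [/\ #[a] = (2 * n)%N, x \notin <[a]>, x ^+ 2 = a ^+ n & x^-1 * a * x = a^-1].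
Proof.
(* ['Z_m] is the ring of integers modulo [m] only when [m > 1]. *)
move=> n_gt0; have n2_gt1 : 1 < 2 * n by rewrite leq_pmulr.
pose T := ('Z_(2 * n) * bool)%type.
have n2_0 : ((2 * n)%:R = 0 :> 'Z_(2 * n))%R by apply: pchar_Zp.
have nN : (- n%:R = n%:R :> 'Z_(2 * n))%R.
  by apply/eqP; rewrite eq_sym -GRing.addr_eq0 -GRing.natrD addnn -mul2n n2_0.
(* Moving [a] left past [x] inverts it, whence the sign; a second [x] yields [x ^+ 2 = a ^+ n],
   whence the shift by [n]. *)
pose fa (u : T) : T := (u.1 + (-1) ^+ u.2, u.2)%R.
pose fx (u : T) : T := (u.1 + n%:R *+ u.2, ~~ u.2)%R.
have inj_fa : injective fa.
  move=> [i b] [j c] e; have eq_bc : b = c by have /= := congr1 snd e.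
  by have := congr1 fst e; rewrite eq_bc /= => /GRing.addIr->.
have inj_fx : injective fx.
  move=> [i b] [j c] e; have eq_bc : b = c by have /= /negb_inj := congr1 snd e.
  by have := congr1 fst e; rewrite eq_bc /= => /GRing.addIr->.
exists {perm T}, (perm inj_fa), (perm inj_fx).
set a := perm inj_fa; set x := perm inj_fx.
have aXE k u : (a ^+ k) u = (u.1 + (-1) ^+ u.2 *+ k, u.2)%R.
  elim: k => [|k IHk]; first by rewrite perm1 GRing.mulr0n GRing.addr0; case: u.
  by rewrite expgSr permM IHk permE /fa /= GRing.mulrSr GRing.addrA.
split.
- apply/eqP; rewrite eqn_dvd order_dvdn; apply/andP; split.
    apply/eqP/permP=> -[i b]; rewrite aXE perm1 /=.
    by rewrite -GRing.mulr_natr n2_0 GRing.mulr0 GRing.addr0.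
  have := aXE #[a] (0, false)%R.
  rewrite expg_order perm1 /= GRing.expr0 GRing.add0r => -[/esym/(congr1 val)].
  by rewrite /= val_Zp_nat // => /eqP.
(* Powers of [a] fix the second coordinate, while [x] flips it. *)
- apply/negP=> /cycleP[k] /(congr1 (fun s : {perm T} => s (0, false)%R)).
  by rewrite aXE permE.
- apply/permP=> -[i b]; rewrite aXE expgS expg1 permM !permE /fx /=.
  congr (_, _); last exact: negbK.
  case: b; rewrite /= !GRing.mulr0n !GRing.mulr1n ?GRing.addr0 //.
  by rewrite GRing.mulNrn nN.
have axa : a * x * a = x.
  apply/permP=> -[i b]; rewrite !permM !permE /fa /fx /=; congr (_, _).
  rewrite GRing.addrAC; congr (_ + _)%R.
  by case: b; rewrite /= ?GRing.addrK ?GRing.addrNK.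
by apply: (mulIg a); rewrite mulVg -!mulgA (mulgA a x a) axa mulVg.
Qed.

(** The relations alone only bound the order from above; mapping [G] onto the subgroup generated in
    the model bounds it from below. *)
Lemma dicyclic_card (n : nat) (gT : finGroupType) (G : {group gT}) : 0 < n ->
  G \isog Grp (a : x : a ^+ (2 * n) = 1, x ^+ 2 = a ^+ n, x^-1 * a * x = a^-1) ->
  4 * n <= #|G|.
Proof.
move=> n_gt0 isoG; have [rT [a [x [oa nax x2 xax]]]] := dicyclic_faithful_model n_gt0.
pose H := (<[a]> <*> <[x]>)%G.
have homH : H \homg G.
  rewrite isoG; apply/existsP; exists (a, x).
  by rewrite /= !xpair_eqE -oa expg_order x2 xax !eqxx.
apply: leq_trans (dvdn_leq (cardG_gt0 _) (card_homg homH)).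
have i_gt1 : 1 < #|H : <[a]>|.
  rewrite indexg_gt1 join_subG subxx cycle_subG; exact: nax.
rewrite -(Lagrange (joing_subl <[a]> <[x]> : _ \subset H)) -orderE oa.
by apply: leq_trans (leq_mul (leqnn (2 * n)) i_gt1); rewrite mulnAC.
Qed.

Lemma dicyclic_structure (n : nat) (gT : finGroupType) (G : {group gT}) : 0 < n ->
  G \isog Grp (a : x : a ^+ (2 * n) = 1, x ^+ 2 = a ^+ n, x^-1 * a * x = a^-1) ->
  exists a : gT, [/\ #[a] = (2 * n)%N, <[a]> \subset G, #|G : <[a]>| = 2
    & {in G :\: <[a]>, forall y, y ^+ 2 = a ^+ n}].
Proof.
move=> n_gt0 isoG; have leG := dicyclic_card n_gt0 isoG.
have /existsP[[a x] /= /eqP[defG a2n x2 xax]] := isoGrp_hom isoG.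
have ax : a ^ x = a^-1 by rewrite conjgE -xax mulgA.
have nax : x \in 'N(<[a]>).
  by apply/normP; rewrite -cycleJ ax cycleV.
have sAG : <[a]> \subset G by rewrite -defG joing_subl.
have le_a : #[a] <= 2 * n.
  by rewrite dvdn_leq ?muln_gt0 // order_dvdn a2n.
(* The quotient by [<[a]>] is generated by the image of [x], whose square is trivial because
   [x ^+ 2] is a power of [a]. *)
have le_i : #|G : <[a]>| <= 2.
  rewrite -card_quotient -defG ?join_subG ?normG ?cycle_subG //.
  rewrite quotientYidl ?cycle_subG // quotient_cycle // -orderE.
  rewrite dvdn_leq // order_dvdn -morphX // x2; apply/eqP/coset_id.
  exact: mem_cycle.
(* The two upper bounds multiply to [4 * n], so the lower bound on [#|G|] makes both equalities. *)
have [oa i2] : #[a] = (2 * n)%N /\ #|G : <[a]>| = 2.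
  move: leG le_a le_i; rewrite -(Lagrange sAG) -orderE.
  by move: #[a] #|G : _|%g => o i; nia.
exists a; split=> // y GAy.
have nAx : x \in G :\: <[a]>.
  have Gx : x \in G by rewrite -defG (subsetP (joing_subr _ _)) ?cycle_id.
  rewrite inE Gx andbT; apply/negP=> Ax.
  have: 1 < #|G : <[a]>| by rewrite i2.
  by rewrite indexg_gt1 -defG join_subG subxx cycle_subG Ax.
(* Write [y = a ^+ i * x]; moving [x] left past the second [a ^+ i] inverts that power, so [y ^+ 2 =
   a ^+ i * a ^+ n * a ^- i = a ^+ n]. *)
rewrite -(rcoset_index2 sAG i2 nAx) in GAy.
have [_ /cycleP[i ->] ->] := rcosetP GAy.
rewrite expgS expg1 -mulgA (conjgC (a ^+ i) x) (mulgA x) -expg2 x2.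
by rewrite conjXg ax expVgn mulgA -expgD addnC expgD mulgK.
Qed.

End DicyclicOrder.

Theorem proposition2p16 (n : nat) (hn : 1 <= n)
    (gT : finGroupType) (Dic : {group gT})
    (hDic : (Dic \isog Grp (a : x : a ^+ (2 * n) = 1, x ^+ 2 = a ^+ n,
                                     x^-1 * a * x = a^-1))%g) :
  simple_ratio Dic = ((omega (2 * n))%:R / (tau (2 * n) + sigma n)%:R)%R.
Proof.
have [a [oa sAG iA sqrG]] := dicyclic_structure hn hDic.
have oz : #[a ^+ n]%g = 2.
  by rewrite orderXdiv oa ?dvdn_mull // mulnK.
rewrite /simple_ratio.
rewrite (nb_simple_subgroups_cyclic_index2 (cycle_cyclic a) sAG iA oz sqrG).
rewrite (card_subgroups_cyclic_index2 (cycle_cyclic a) sAG iA oz sqrG).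
by rewrite -orderE oa mulKn.
Qed.
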